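(* Let $K$ be a compact set of a metric space, let $W(x) > 0$ and $W_0(x)$ be continuous functionals on $K$, and let $\beta$ be a number. Put $$J(x) = \frac{W_0(x)}{W(x)}, \qquad J_\beta(x) = W_0(x) - \beta W(x).$$ Consider the extremal problems $J \to \max$ over $K$ and $J_\beta \to \max$ over $K$. Let $x_{\max}$ be a solution of the first problem and $x_\beta$ a solution of the second, and put $\beta_{\max} = J(x_{\max})$ and $j(\beta) = J_\beta(x_\beta)$. Then: (1) $j(\beta) < 0$ for $\beta > \beta_{\max}$, $j(\beta) > 0$ for $\beta < \beta_{\max}$, and $j(\beta) = 0$ for $\beta = \beta_{\max}$; so $\beta_{\max}$ is the only solution of the equation $j(\beta) = 0$. (2) The functionals $J(x)$ and $J_{\beta_{\max}}(x)$ take their maxima over $K$ at the same point $x_{\max} = x_{\beta_{\max}}$. (3) The function $\beta \mapsto x_\beta$ is continuous in every compact segment $[\beta_1, \beta_2]$.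
   Context: The functionals $W$, $W_0$ are real-valued and $\beta$ is a real number. A solution of a problem ''$F \to \max$ over $K$'' is a point of $K$ at which $F$ attains its maximum over $K$. The solutions $x_{\max}$ and $x_\beta$ exist under the hypotheses but may be not unique; the equality $x_{\max} = x_{\beta_{\max}}$ in part (2) is understood in the sense that one can take $x_{\beta_{\max}} = x_{\max}$.
   Formalization: Part (3) fails when solutions are not unique (K={0,1}, W=1+x, W_0=x on [0,2]); continuity of x_β is proved on segments where the solution x_β is unique, and in general the set of solutions is shown to be upper hemicontinuous in β. *)

(* Defs.v *)
From HB Require Import structures.
From mathcomp Require Import all_boot all_order all_algebra.
From mathcomp Require Import all_classical all_reals all_analysis.

Set Implicit Arguments.
Unset Strict Implicit.
Unset Printing Implicit Defensive.

Import Order.TTheory GRing.Theory Num.Theory.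
Import numFieldNormedType.Exports.

Local Open Scope classical_set_scope.
Local Open Scope ring_scope.

(* [argmax K F x] says that x is a solution of the problem F -> max over K. *)
Definition argmax (R : realType) (M : Type) (K : set M) (F : M -> R) : set M :=
  [set x | K x /\ forall y, K y -> F y <= F x].

Definition Jratio (R : realType) (M : Type) (W0 W : M -> R) (x : M) : R :=
  W0 x / W x.

Definition Jpar (R : realType) (M : Type) (W0 W : M -> R) (beta : R) (x : M)
    : R :=
  W0 x - beta * W x.

(* Continuity (upper hemicontinuity) relative to A of the multivalued map
   beta |-> S beta.  When every S beta with beta in A is a singleton [set f beta],
   this is the continuity of f on A. *)
Definition upper_hemicontinuous_on (R : realType) (M : topologicalType)
    (A : set R) (S : R -> set M) : Prop :=
  forall beta, A beta -> forall U : set M, open U -> S beta `<=` U ->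
    \forall gamma \near within A (nbhs beta), S gamma `<=` U.

(* Main.v *)
Require Import Defs.
From HB Require Import structures.
From mathcomp Require Import all_boot all_order all_algebra.
From mathcomp Require Import all_classical all_reals all_analysis.
From mathcomp Require Import ring lra.

Set Implicit Arguments.
Unset Strict Implicit.
Unset Printing Implicit Defensive.

Import Order.TTheory GRing.Theory Num.Theory.
Import numFieldNormedType.Exports.

Local Open Scope classical_set_scope.
Local Open Scope ring_scope.

(** Clearing the positive denominator [W] shows that [J y] and [beta] compare
    in the same way as [J_beta y] and [0] ([Jratio_le], [Jratio_lt]). Hence
    [beta_max = max J] says exactly that [J_beta_max <= 0] on [K] with equality
    at the maximizers of [J], which is part (2) and [j beta_max = 0]; the other
    two signs of [j] in part (1) are read off in the same way, at every point
    of [K] for [beta > beta_max] and at [xmax] for [beta < beta_max].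

    Part (3) is a stability property of maximizers ([argmax_stable]). If all
    the maximizers of a continuous [f] on a compact [K] lie in an open [U],
    then on the compact set [K `\` U] the values of [f] stay below its maximum
    by a definite gap, so a function uniformly close enough to [f] cannot
    attain its maximum outside [U]. As [W] is bounded on [K], [J_gamma] tends
    to [J_beta] uniformly on [K] when [gamma] tends to [beta]. *)

Lemma argmax_nonempty (R : realType) (T : topologicalType) (K : set T)
    (f : T -> R) :
  compact K -> K !=set0 -> {within K, continuous f} -> argmax K f !=set0.
Proof.
move=> cK K0 cf; have [x Kx xmax] := compact_EVT_max K0 cK cf.
exists x; split; first exact: set_mem.
by move=> y Ky; apply: xmax; exact: mem_set.
Qed.

(** The gap between the maximum of [f] and its maximum over the compact set
    [K `\` U] is positive because a maximizer of [f] lies in [U]; a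
    perturbation by less than half of it keeps the maximizers inside [U]. *)
Lemma argmax_stable (R : realType) (T : topologicalType) (K U : set T)
    (f : T -> R) :
  compact K -> {within K, continuous f} -> open U -> argmax K f `<=` U ->
  exists2 e : R, 0 < e &
    forall g : T -> R, (forall x, K x -> `|g x - f x| < e) ->
      argmax K g `<=` U.
Proof.
move=> cK cf oU fU.
have [KU0|/set0P KU0] := eqVneq (K `\` U) set0.
  exists 1 => // g _ x [Kx _]; apply: contrapT => Ux.
  by suff: set0 x by []; rewrite -KU0.
have [x0 [Kx0 x0max]] : argmax K f !=set0.
  by apply: argmax_nonempty => //; case: KU0 => x [Kx _]; exists x.
have [y0 [[Ky0 Uy0] y0max]] : argmax (K `\` U) f !=set0.
  apply: argmax_nonempty => //.
    by rewrite setDE; apply: compact_closedI => //; exact: open_closedC.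
  by apply: continuous_subspaceW cf; exact: subDsetl.
have gap : f y0 < f x0.
  rewrite ltNge; apply/negP => x0y0; apply/Uy0/fU; split=> // z Kz.
  by rewrite (le_trans _ x0y0) ?x0max.
exists ((f x0 - f y0) / 2); first by lra.
move=> g fg x [Kx xmax]; apply: contrapT => Ux.
have := y0max x (conj Kx Ux); have := xmax x0 Kx0.
have := fg x Kx; have := fg x0 Kx0; rewrite !ltr_distl => /andP[? ?] /andP[? ?].
lra.
Qed.

Section Functionals.
Context (R : realType) (M : topologicalType) (K : set M) (W W0 : M -> R).
Implicit Types (beta : R) (x : M).

Lemma Jratio_le beta x :
  0 < W x -> (Jratio W0 W x <= beta) = (Jpar W0 W beta x <= 0).
Proof. by move=> Wx; rewrite /Jratio /Jpar ler_pdivrMr// subr_le0. Qed.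

Lemma Jratio_lt beta x :
  0 < W x -> (Jratio W0 W x < beta) = (Jpar W0 W beta x < 0).
Proof. by move=> Wx; rewrite /Jratio /Jpar ltr_pdivrMr// subr_lt0. Qed.

Lemma Jpar_Jratio x : 0 < W x -> Jpar W0 W (Jratio W0 W x) x = 0.
Proof.
by move=> Wx; rewrite /Jpar /Jratio mulfVK ?subrr// gt_eqF.
Qed.

Lemma Jratio_continuous :
  {within K, continuous W} -> {within K, continuous W0} ->
  (forall x, K x -> 0 < W x) -> {within K, continuous (Jratio W0 W)}.
Proof.
move=> W_cont W0_cont W_pos; apply/subspace_continuousP => x Kx.
apply: cvgM; first exact: (subspace_continuousP _ _).1 W0_cont x Kx.
apply: cvgV; first by rewrite gt_eqF ?W_pos.
exact: (subspace_continuousP _ _).1 W_cont x Kx.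
Qed.

Lemma Jpar_continuous beta :
  {within K, continuous W} -> {within K, continuous W0} ->
  {within K, continuous (Jpar W0 W beta)}.
Proof.
move=> W_cont W0_cont x; apply: cvgB; first exact: W0_cont.
by apply: cvgM; [exact: cvg_cst | exact: W_cont].
Qed.

(** If [W <= C] on [K], then [J_gamma] and [J_beta] differ by at most
    [C |gamma - beta|] on [K], so [argmax_stable] applies to them. *)
Lemma argmax_Jpar_upper_hemicontinuous (A : set R) :
  compact K -> {within K, continuous W} -> {within K, continuous W0} ->
  (forall x, K x -> 0 < W x) ->
  upper_hemicontinuous_on A (fun beta => argmax K (Jpar W0 W beta)).
Proof.
move=> cK W_cont W0_cont W_pos beta _ U oU SU.
have [e e0 stable] := argmax_stable cK (Jpar_continuous W_cont W0_cont) oU SU.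
have [K0|/set0P K0] := eqVneq K set0.
  by apply: nearW => gamma x [Kx _]; rewrite K0 in Kx.
have [z [Kz zmax]] := argmax_nonempty cK K0 W_cont.
have near_beta : \forall gamma \near beta, `|beta - gamma| < e / W z.
  by apply: nbhsx_ballx; rewrite divr_gt0 ?W_pos.
apply: cvg_within; move: near_beta.
apply: filterS => gamma; rewrite ltr_pdivlMr ?W_pos// => close.
apply: stable => x Kx; rewrite /Jpar.
have -> : W0 x - gamma * W x - (W0 x - beta * W x) = (beta - gamma) * W x.
  by ring.
rewrite normrM (gtr0_norm (W_pos x Kx)); apply: le_lt_trans close.
by rewrite ler_wpM2l// zmax.
Qed.

End Functionals.

(** When [S beta] is reduced to [f beta], every open neighbourhood of [f beta]
    contains all of [S beta], hence all of [S gamma] for [gamma] near [beta],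
    and [f gamma] is one of its points. *)
Lemma upper_hemicontinuous_selection (R : realType) (T : topologicalType)
    (A : set R) (S : R -> set T) (f : R -> T) :
  upper_hemicontinuous_on A S -> (forall beta, S beta (f beta)) ->
  (forall beta, A beta -> is_subset1 (S beta)) -> {within A, continuous f}.
Proof.
move=> uhc Sf S1; apply/subspace_continuousP => beta Abeta V.
rewrite nbhsE => -[U [oU Uf] UV].
have SU : S beta `<=` U.
  by move=> x Sx; rewrite (S1 beta Abeta x (f beta) Sx (Sf beta)).
apply: filterS (uhc beta Abeta U oU SU) => gamma /(_ _ (Sf gamma)).
exact: UV.
Qed.

Theorem theorem1 (R : realType) (M : metricType R) (K : set M) (W W0 : M -> R)
    (K_compact : compact K) (K_nonempty : K !=set0)
    (W_cont : {within K, continuous W}) (W0_cont : {within K, continuous W0})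
    (W_pos : forall x, K x -> 0 < W x) :
  (* both problems have solutions *)
  argmax K (Jratio W0 W) !=set0 /\
  (forall beta, argmax K (Jpar W0 W beta) !=set0) /\
  (forall (xmax : M) (xsol : R -> M),
    argmax K (Jratio W0 W) xmax ->
    (forall beta, argmax K (Jpar W0 W beta) (xsol beta)) ->
    let beta_max := Jratio W0 W xmax in
    let j := fun beta => Jpar W0 W beta (xsol beta) in
    (* (1) *)
    ((forall beta, beta_max < beta -> j beta < 0) /\
     (forall beta, beta < beta_max -> 0 < j beta) /\
     j beta_max = 0 /\
     (forall beta, j beta = 0 <-> beta = beta_max)) /\
    (* (2) *)
    argmax K (Jpar W0 W beta_max) xmax /\
    (* (3): as a multivalued map in general, and for x_beta itself wherever
       it is single-valued *)
    (forall beta1 beta2, beta1 <= beta2 ->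
      upper_hemicontinuous_on `[beta1, beta2]
        (fun beta => argmax K (Jpar W0 W beta)) /\
      ((forall beta, beta \in `[beta1, beta2] ->
          is_subset1 (argmax K (Jpar W0 W beta))) ->
       {within `[beta1, beta2], continuous xsol}))).
Proof.
split; first by apply: argmax_nonempty => //; exact: Jratio_continuous.
split; first by move=> beta; apply: argmax_nonempty; last exact: Jpar_continuous.
move=> xmax xsol [Kxmax Jmax] xsolP bm j.
have Wxmax := W_pos _ Kxmax.
have xmaxP : argmax K (Jpar W0 W bm) xmax.
  split=> // y Ky; rewrite Jpar_Jratio// -Jratio_le ?W_pos//.
  exact: Jmax.
have j_neg beta : bm < beta -> j beta < 0.
  have [Kx _] := xsolP beta.
  by move=> bm_lt; rewrite -Jratio_lt ?W_pos// (le_lt_trans (Jmax _ Kx)).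
have j_pos beta : beta < bm -> 0 < j beta.
  have [_ /(_ xmax Kxmax)] := xsolP beta.
  move=> Jle lt_bm; apply: lt_le_trans Jle.
  by rewrite ltNge -Jratio_le// -ltNge.
have j_zero : j bm = 0.
  have [Kx xsol_max] := xsolP bm.
  rewrite -(Jpar_Jratio W0 Wxmax); apply: le_anti.
  by rewrite xsol_max// xmaxP.2.
split.
  do 3![split=> //] => beta; split=> [jb|->//].
  by have [/j_pos|/j_neg|//] := ltgtP beta bm; rewrite jb ltxx.
split=> // beta1 beta2 _.
have uhc := @argmax_Jpar_upper_hemicontinuous R M K W W0 `[beta1, beta2]
  K_compact W_cont W0_cont W_pos.
split=> // S1.
exact: upper_hemicontinuous_selection uhc xsolP S1.
Qed.
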